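(* Let $\lfloor z\rceil=\lfloor \operatorname{Re}z+\tfrac12\rfloor+\lfloor \operatorname{Im}z+\tfrac12\rfloor i$ be the nearest integer (Hurwitz) choice function, whose fundamental set $K$ is the closed unit square $\{z:|\operatorname{Re}z|\le\tfrac12,\ |\operatorname{Im}z|\le\tfrac12\}$. Define $$K_1=\{z\in K:\operatorname{Re}z\le0,\ |z-i|\ge1,\ |z+i|\ge1\},$$ $$K_2=\{z\in K:|z-i|\le1,\ |z+1|\le1,\ |z-(-1+i)|\ge1\},$$ $$K_3=\{z\in K:|z-(-1+i)|\le1\},$$ $$K_j=-i\,K_{j-3}\quad\text{for }j=4,\dots,12.$$ Then the nearest integer algorithm satisfies the finite building property with $\mathcal{P}=\{K_1,\dots,K_{12}\}$.
   Context: Here $i=\sqrt{-1}$. For a choice function $\lfloor\cdot\rceil$ (a map to $\mathbb{Z}[i]$ with $|z-\lfloor z\rceil|\le1$) the fundamental set is $K=\overline{\{z-\lfloor z\rceil\}}$, and the Gauss map $G:K\to K$ is $G(z)=-1/z-\lfloor-1/z\rceil$ for $z\neq0$, $G(0)=0$. A finite partition of $K$ is a finite collection of closed sets with boundaries of zero Lebesgue measure and pairwise disjoint interiors whose union is $K$. A set is buildable from a collection $\mathcal{C}$ of closed sets (with null boundaries) if it is equal, up to measure zero, to some union of elements of $\mathcal{C}$. The algorithm satisfies the finite building property with $\mathcal{P}=\{K_1,\dots,K_N\}$ if $N>1$, $\mathcal{P}$ is a finite partition of $K$, and each $G(K_j)$ is buildable from $\mathcal{P}$. *)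

(* Defs.v *)
From HB Require Import structures.
From mathcomp Require Import all_boot all_order all_algebra complex.
From mathcomp Require Import all_classical all_reals all_analysis.
From mathcomp Require Import ring lra.

Set Implicit Arguments.
Unset Strict Implicit.
Unset Printing Implicit Defensive.

Import Order.TTheory GRing.Theory Num.Theory.
Import numFieldNormedType.Exports.

Local Open Scope classical_set_scope.
Local Open Scope ring_scope.

(* The topology on R[i] is the one induced by the modulus, which the library
   attaches to the regular module R[i]^o. *)
Definition C_closed (R : realType) (A : set R[i]) : Prop :=
  closed (A : set R[i]^o).

Definition C_closure (R : realType) (A : set R[i]) : set R[i] :=
  closure (A : set R[i]^o).

Definition C_interior (R : realType) (A : set R[i]) : set R[i] :=
  interior (A : set R[i]^o).

Definition C_boundary (R : realType) (A : set R[i]) : set R[i] :=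
  C_closure A `\` C_interior A.

(* Null sets for two-dimensional Lebesgue measure, z being identified with
   (Re z, Im z). *)
Definition C_null (R : realType) (A : set R[i]) : Prop :=
  (lebesgue_measure \x lebesgue_measure)%E.-negligible
    ((fun z : R[i] => (complex.Re z, complex.Im z)
        : measurableTypeR R * measurableTypeR R) @` A).

Definition gaussian_int (R : realType) (z : R[i]) : Prop :=
  exists m n : int, z = (m%:~R +i* n%:~R)%C.

Record choice_function (R : realType) := ChoiceFunction {
  choice_fun :> R[i] -> R[i];
  choice_fun_int : forall z, gaussian_int (choice_fun z);
  choice_fun_dist : forall z, `|z - choice_fun z| <= 1 }.

Definition fundamental_set (R : realType) (f : choice_function R) : set R[i] :=
  C_closure [set z - f z | z in setT].

Definition gauss_map (R : realType) (f : choice_function R) (z : R[i]) : R[i] :=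
  if z == 0 then 0 else - 1 / z - f (- 1 / z).

Definition finite_partition (R : realType) (K : set R[i])
    (N : nat) (P : 'I_N -> set R[i]) : Prop :=
  [/\ forall j, C_closed (P j),
      forall j, C_null (C_boundary (P j)),
      forall i j, i != j -> C_interior (P i) `&` C_interior (P j) = set0 &
      \bigcup_j P j = K].

Definition buildable (R : realType) (I : Type) (P : I -> set R[i])
    (A : set R[i]) : Prop :=
  exists J : set I, C_null (A `+` \bigcup_(j in J) P j).

(* Injectivity of P says that K_1, ..., K_N are N different sets, so that N is
   the number of elements of the collection. *)
Definition finite_building_property (R : realType) (f : choice_function R)
    (N : nat) (P : 'I_N -> set R[i]) : Prop :=
  [/\ (1 < N)%N,
      injective P,
      finite_partition (fundamental_set f) P &
      forall j, buildable P (gauss_map f @` P j)].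

Definition nearest_int (R : realType) (z : R[i]) : R[i] :=
  ((Num.floor (complex.Re z + 2^-1))%:~R
     +i* (Num.floor (complex.Im z + 2^-1))%:~R)%C.

Lemma nearest_int_int (R : realType) (z : R[i]) : gaussian_int (nearest_int z).
Proof. by do 2 eexists. Qed.

Lemma nearest_int_dist (R : realType) (z : R[i]) : `|z - nearest_int z| <= 1.
Proof.
case: z => x y; rewrite normc_def /= (_ : 1 = (1%:C)%C)// lecR.
rewrite -[leRHS]sqrtr1 ler_sqrt//.
have aux (t : R) : (t - (Num.floor (t + 2^-1))%:~R) ^+ 2 <= 2^-1.
  have := floor_le (t + 2^-1); have := floorD1_gt (t + 2^-1).
  rewrite intrD; move: (_%:~R) => n; nra.
have := aux x; have := aux y; lra.
Qed.

Definition hurwitz (R : realType) : choice_function R :=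
  ChoiceFunction (@nearest_int_int R) (@nearest_int_dist R).

Definition unit_square (R : realType) : set R[i] :=
  [set z | `|complex.Re z| <= 2^-1 /\ `|complex.Im z| <= 2^-1].

(* hurwitz_piece R i is K_(i+1), for i = 0, ..., 11. *)
Fixpoint hurwitz_piece (R : realType) (i : nat) : set R[i] :=
  let K := fundamental_set (hurwitz R) in
  match i with
  | 0 => [set z | [/\ K z, complex.Re z <= 0,
                      1 <= `|z - 'i%C| & 1 <= `|z + 'i%C|]]
  | 1 => [set z | [/\ K z, `|z - 'i%C| <= 1, `|z + 1| <= 1 &
                      1 <= `|z - (- 1 + 'i%C)|]]
  | 2 => [set z | K z /\ `|z - (- 1 + 'i%C)| <= 1]
  | i'.+3 => [set - 'i%C * z | z in hurwitz_piece i']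
  end.

Arguments unit_square R : clear implicits.
Arguments hurwitz_piece R i : clear implicits.

(* Main.v *)
(* In fact every G(K_j) is the whole square K up to its boundary. The map
   z |-> - 1 / z carries the discs and half-planes cutting out K_1, K_2, K_3 to
   discs and half-planes; the image of K_1 contains the unit square about 3,
   that of K_2 the one about 3 + 3i, and the image of K_3 meets the squares
   about 1 + i, 1 + 2i, 2 + i, 2 + 2i in four regions whose translates cover K.
   Multiplication by - i transports this to the other pieces. *)
Require Import Defs.
From mathcomp Require Import all_boot all_order all_algebra complex.
From mathcomp Require Import all_classical all_reals all_analysis.
From mathcomp Require Import measurable_realfun ring lra.

Set Implicit Arguments.
Unset Strict Implicit.
Unset Printing Implicit Defensive.

Import Order.TTheory GRing.Theory Num.Theory.
Import numFieldNormedType.Exports.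

Local Open Scope classical_set_scope.
Local Open Scope ring_scope.

(** * Modulus conditions in real coordinates, and continuity of the coordinates *)

Lemma normcr_le1 (R : rcfType) (z : R[i]) :
  (`|z| <= 1) = (complex.Re z ^+ 2 + complex.Im z ^+ 2 <= 1).
Proof.
by rewrite normc_def (_ : 1 = (1%:C)%C)// lecR -[X in _ <= X]sqrtr1 ler_sqrt.
Qed.

Lemma normcr_ge1 (R : rcfType) (z : R[i]) :
  (1 <= `|z|) = (1 <= complex.Re z ^+ 2 + complex.Im z ^+ 2).
Proof.
rewrite normc_def (_ : 1 = (1%:C)%C)// lecR -[X in X <= _]sqrtr1 ler_sqrt//.
by rewrite addr_ge0 ?sqr_ge0.
Qed.

Lemma Re_continuous (R : realType) :
  continuous (fun z : R[i]^o => complex.Re z : R^o).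
Proof.
move=> z A /nbhs_normP[e /= e0 eA].
apply/(@nbhs_normP _ R[i]^o); exists (e%:C)%C; rewrite /= ?ltcR// => w /= zw.
apply: eA; rewrite /= -ltcR; apply: le_lt_trans zw.
by rewrite -raddfB/= normc_ge_Re.
Qed.

Lemma Im_continuous (R : realType) :
  continuous (fun z : R[i]^o => complex.Im z : R^o).
Proof.
move=> z A /nbhs_normP[e /= e0 eA].
apply/(@nbhs_normP _ R[i]^o); exists (e%:C)%C; rewrite /= ?ltcR// => w /= zw.
apply: eA; rewrite /= -ltcR; apply: le_lt_trans zw.
rewrite normc_def lecR -[X in X <= _]sqrtr_sqr ler_wsqrtr// !raddfB/=.
by rewrite lerDr sqr_ge0.
Qed.

(** * Regions cut out by circles and lines: closedness, interior, null boundary *)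

Section conic.
Context {R : realType}.

(** Generalised circles: a line when [a = 0], a circle otherwise. The family is stable under quarter
    turns and under the inversion [-1 / z]. *)
Definition conic (k : R * R * R * R) (x y : R) : R :=
  let: (a, b, c, d) := k in a * (x ^+ 2 + y ^+ 2) + b * x + c * y + d.

(** Positive discriminant: a circle of positive radius, or a genuine line when [a = 0]. *)
Definition smooth_form (k : R * R * R * R) : bool :=
  let: (a, b, c, d) := k in 4 * a * d < b ^+ 2 + c ^+ 2.

(** Pullback along multiplication by ['i]; it therefore describes the image of a region under
    multiplication by [- 'i]. *)
Definition rot_form (k : R * R * R * R) : R * R * R * R :=
  let: (a, b, c, d) := k in (a, c, - b, d).

Lemma conic_rot_form k x y : conic (rot_form k) x y = conic k (- y) x.
Proof. by case: k => [[[a b] c] d] /=; ring. Qed.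

Lemma smooth_rot_form k : smooth_form (rot_form k) = smooth_form k.
Proof. by case: k => [[[a b] c] d] /=; rewrite sqrrN addrC. Qed.

Lemma conic_continuous k :
  continuous (fun z : R[i]^o => conic k (complex.Re z) (complex.Im z) : R^o).
Proof.
case: k => [[[a b] c] d] /= z.
have cR := @Re_continuous R z; have cI := @Im_continuous R z.
have cst (t : R) : {for z, continuous (fun _ : R[i]^o => t : R^o)}.
  exact: cst_continuous.
exact: (continuousD (continuousD (continuousD (continuousM (cst a)
  (continuousD (continuousM cR cR) (continuousM cI cI)))
  (continuousM (cst b) cR)) (continuousM (cst c) cI)) (cst d)).
Qed.

Lemma roots_finite_quadratic (a c e : R) : (a != 0) || (c != 0) ->
  finite_set [set y : R | a * y ^+ 2 + c * y + e = 0].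
Proof.
move=> ac.
set p : {poly R} := a *: 'X^2 + c *: 'X + e%:P.
have p0 : p != 0.
  apply/eqP => p0; have := congr1 (fun q : {poly R} => q`_1) p0.
  have := congr1 (fun q : {poly R} => q`_2) p0.
  rewrite /p !coefE/= ?mulr1 ?mulr0 ?addr0 ?add0r => a0 c0.
  by move: ac; rewrite a0 c0 eqxx.
have pE y : p.[y] = a * y ^+ 2 + c * y + e by rewrite /p !hornerE.
(* The roots are collected by induction on the size, splitting off one linear factor per root. *)
have [s rs] : exists s : seq R, forall y, root p y -> y \in s.
  move: p0; clearbody p; clear pE ac.
  have [n sp] := ubnP (size p); elim: n p sp => // n IH p sp p0.
  have [[y ry]|nr] := pselect (exists y, root p y); last first.
    by exists [::] => y ry; exfalso; apply: nr; exists y.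
  have [q pq] := factor_theorem _ _ ry.
  have q0 : q != 0 by apply: contraNneq p0 => q0; rewrite pq q0 mul0r.
  have [|s rs] := IH q _ q0.
    by move: sp; rewrite pq size_Mmonic ?monicXsubC// size_XsubC addn2.
  exists (y :: s) => x; rewrite pq rootM root_XsubC inE => /orP[/rs ->|->//].
  by rewrite orbT.
apply: (@sub_finite_set _ _ [set` s]); last exact: finite_seq.
by move=> y /= yE; apply: rs; rewrite /root pE yE.
Qed.

(** By Fubini: the sections at fixed [x] are finite unless [a = c = 0], and then the zero set is the
    vertical line [x = - d / b]. *)
Lemma conic_null k : smooth_form k ->
  C_null [set z : R[i] | conic k (complex.Re z) (complex.Im z) = 0].
Proof.
case: k => [[[a b] c] d] /= ndk.
pose Z := [set p : measurableTypeR R * measurableTypeR R |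
  a * (p.1 ^+ 2 + p.2 ^+ 2) + b * p.1 + c * p.2 + d = 0].
have mZ : measurable Z.
  have mf : measurable_fun setT
      (fun p : measurableTypeR R * measurableTypeR R =>
         a * (p.1 ^+ 2 + p.2 ^+ 2) + b * p.1 + c * p.2 + d).
    apply: measurable_funD => //; apply: measurable_funD.
      apply: measurable_funD; apply: measurable_funM => //.
      by apply: measurable_funD; apply: measurable_funX.
    exact: measurable_funM.
  by rewrite -[Z]setTI; apply: (mf measurableT [set 0]).
rewrite /C_null; apply: (negligibleS (A := Z)).
  by move=> _ [[x y]/= h <-].
have [|/norP[/negPn/eqP a0 /negPn/eqP c0]] := boolP ((a != 0) || (c != 0)).
  move=> ac; apply/negligibleP => //.
  rewrite /product_measure1; apply: integral0_eq => x _ /=.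
  apply: countable_lebesgue_measure0; apply: finite_set_countable.
  apply: sub_finite_set (roots_finite_quadratic (a * x ^+ 2 + b * x + d) ac).
  move=> y; rewrite /xsection/= inE /Z /= => h.
  by rewrite -[RHS]h; ring.
have b0 : b != 0.
  by apply/eqP => b0; move: ndk;
    rewrite a0 b0 c0 !mulr0 mul0r expr0n/= addr0 ltxx.
apply: (negligibleS (A := [set (- d / b : measurableTypeR R)]
    `*` [set: measurableTypeR R])).
  move=> [x y]; rewrite /Z /= a0 c0 => h; split=> //.
  apply: (mulIf b0); rewrite divfK//; lra.
apply/negligibleP; first exact: measurableX.
apply: etrans (product_measure1E lebesgue_measure lebesgue_measure _ _) _ => //.
by apply: etrans (congr1 (mule^~ _) (lebesgue_measure_set1 _)) (mul0e _).
Qed.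

Lemma C_null_set0 : C_null (set0 : set R[i]).
Proof. by rewrite /C_null image_set0; exact: negligible_set0. Qed.

Lemma C_null_subset (A B : set R[i]) : A `<=` B -> C_null B -> C_null A.
Proof. by move=> AB; apply: negligibleS; exact: image_subset. Qed.

Lemma C_nullU (A B : set R[i]) : C_null A -> C_null B -> C_null (A `|` B).
Proof. by move=> A0 B0; rewrite /C_null image_setU; exact: negligibleU. Qed.

Lemma nbhs_complex (z : R[i]^o) (A : set R[i]^o) : nbhs z A ->
  exists2 e : R, 0 < e & forall u v : R, u ^+ 2 + v ^+ 2 < e ^+ 2 ->
    A ((complex.Re z + u) +i* (complex.Im z + v))%C.
Proof.
(* The radius of a ball is itself an element of [R[i]]; being positive, it has imaginary part
   zero. *)
move=> /nbhs_normP[[e e'] /=]; rewrite ltcE/= => /andP[/eqP -> e0] eA.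
exists e => // u v uv; apply: eA => /=.
case: z => x y /=; rewrite normc_def/= (_ : (e +i* 0)%C = e%:C%C)// ltcR.
rewrite -[ltRHS](gtr0_norm e0) -[ltRHS]sqrtr_sqr ltr_sqrt ?exprn_gt0//.
by rewrite !opprD !addNKr !sqrrN.
Qed.

Definition region (L : seq (R * R * R * R)) : set R[i] :=
  [set z | all (fun k => 0 <= conic k (complex.Re z) (complex.Im z)) L].

Definition open_region (L : seq (R * R * R * R)) : set R[i] :=
  [set z | all (fun k => 0 < conic k (complex.Re z) (complex.Im z)) L].

Lemma region_closed L : C_closed (region L).
Proof.
elim: L => [|k L IH].
  rewrite /C_closed (_ : region _ = setT); first exact: closedT.
  by apply/seteqP; split.
rewrite /C_closed (_ : region _ =
    [set z | 0 <= conic k (complex.Re z) (complex.Im z)] `&` region L).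
  apply: closedI => //; apply: (@preimage_closed R[i]^o R^o _ [set x | 0 <= x]).
    by move=> z _; exact: conic_continuous.
  exact: closed_ge.
by apply/seteqP; split => z /= /andP.
Qed.

Lemma open_region_open L : open (open_region L : set R[i]^o).
Proof.
elim: L => [|k L IH].
  rewrite (_ : open_region _ = setT); first exact: openT.
  by apply/seteqP; split.
rewrite (_ : open_region _ =
    [set z | 0 < conic k (complex.Re z) (complex.Im z)] `&` open_region L).
  apply: openI => //; apply: (@open_comp R[i]^o R^o _ [set x | 0 < x]).
    by move=> z _; exact: conic_continuous.
  exact: open_gt.
by apply/seteqP; split => z /= /andP.
Qed.

Lemma open_region_interior L : open_region L `<=` C_interior (region L).
Proof.
rewrite -[X in X `<=` _]((interior_id _).1 (@open_region_open L)).
by apply: (@interiorS R[i]^o) => z /= /allP h; apply/allP => k /h /ltW.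
Qed.

(* Where a smooth form vanishes its gradient g does not, and
   moving along - t g makes the form negative. *)
Lemma interior_region L : all smooth_form L ->
  C_interior (region L) `<=` open_region L.
Proof.
move=> /allP ndL z zi; apply/allP => k kL.
have zL := @interior_subset R[i]^o _ _ zi.
rewrite lt_neqAle (allP zL _ kL) andbT eq_sym; apply/negP => /eqP k0.
have [e e0 he] := nbhs_complex zi.
have := ndL _ kL; case: k kL k0 => [[[a b] c] d] kL.
set x := complex.Re z; set y := complex.Im z => /= k0 nd.
pose g1 := 2 * a * x + b; pose g2 := 2 * a * y + c.
pose G := g1 ^+ 2 + g2 ^+ 2.
have G0 : 0 < G.
  (* On the zero set the squared norm of the gradient is the discriminant. *)
  have -> : G = b ^+ 2 + c ^+ 2 - 4 * a * d.
    have -> : d = - (a * (x ^+ 2 + y ^+ 2) + b * x + c * y) by lra.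
    by rewrite /G /g1 /g2; ring.
  by rewrite subr_gt0.
(* The step length is [M^-1]: the term in [a] ensures [a * M^-1 < 1], and the last one keeps the
   displacement below [e]. *)
pose M := 1 + `|a| + (1 + G) / e.
have Ge0 : 0 < (1 + G) / e by rewrite divr_gt0//; lra.
have a0 := normr_ge0 a; have M0 : 0 < M by rewrite /M; lra.
have MM : M^-1 * M = 1 by rewrite mulVf ?gt_eqF.
have t0 : 0 < M^-1 by rewrite invr_gt0.
have ta : a * M^-1 < 1.
  by rewrite ltr_pdivrMr// mul1r (le_lt_trans (ler_norm a))// /M; lra.
have te : (M^-1) ^+ 2 * G < e ^+ 2.
  have Me : 1 + G < e * M.
    by rewrite mulrC -ltr_pdivrMr// /M; lra.
  have : G < e ^+ 2 * M ^+ 2.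
    rewrite -exprMn; apply: (@lt_trans _ _ ((1 + G) ^+ 2)); first by nra.
    by rewrite ltr_pXn2r ?nnegrE//; lra.
  by move=> ?; rewrite exprVn mulrC ltr_pdivrMr ?exprn_gt0.
have /he : (- (M^-1 * g1)) ^+ 2 + (- (M^-1 * g2)) ^+ 2 < e ^+ 2.
  by apply: le_lt_trans te; rewrite le_eqVlt; apply/orP; left; apply/eqP;
    rewrite /G; ring.
move=> /allP/(_ _ kL) /=; apply/negP; rewrite -ltNge -/x -/y.
set t := M^-1 in t0 ta te MM *.
have -> : a * ((x - t * g1) ^+ 2 + (y - t * g2) ^+ 2) + b * (x - t * g1)
    + c * (y - t * g2) + d = t * G * (a * t - 1).
  have -> : d = - (a * (x ^+ 2 + y ^+ 2) + b * x + c * y) by lra.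
  by rewrite /G /g1 /g2; ring.
by rewrite pmulr_rlt0 ?mulr_gt0// subr_lt0.
Qed.

Lemma conics_null L : all smooth_form L ->
  C_null [set z : R[i] |
    has (fun k => conic k (complex.Re z) (complex.Im z) == 0) L].
Proof.
elim: L => [|k L IH] /=.
  by move=> _; apply: C_null_subset C_null_set0.
move=> /andP[/conic_null k0 /IH L0]; apply: C_null_subset (C_nullU k0 L0).
by move=> z /= /orP[/eqP|]; [left|right].
Qed.

(** A point of the region where no form vanishes is interior, so the boundary lies in finitely many
    null curves. *)
Lemma region_boundary_null L : all smooth_form L ->
  C_null (C_boundary (region L)).
Proof.
move=> ndL; apply: C_null_subset (conics_null ndL) => z [].
rewrite /C_closure -(closure_id _).1; last exact: region_closed.
move=> /allP zL zi; apply/negPn/negP => /hasPn h; apply: zi.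
apply: open_region_interior; apply/allP => k kL.
by rewrite lt_neqAle eq_sym h// zL.
Qed.

End conic.

Section hurwitz.
Context {R : realType}.

(** * The fundamental set and the twelve pieces as regions *)

Definition square_forms : seq (R * R * R * R) :=
  [:: (0, 1, 0, 2^-1); (0, -1, 0, 2^-1); (0, 0, 1, 2^-1); (0, 0, -1, 2^-1)].

Lemma unit_squareE : unit_square R = region square_forms.
Proof.
rewrite /unit_square /region.
apply/seteqP; split => -[x y] /=; rewrite !ler_norml.
  by move=> [/andP[? ?] /andP[? ?]]; do !(apply/andP; split) => //; lra.
move=> /and5P[? ? ? ? _]; split; apply/andP; split; lra.
Qed.

Lemma floor_half (x : R) (m : int) : `|x| < 2^-1 ->
  Num.floor (x + m%:~R + 2^-1) = m.
Proof.
by rewrite ltr_norml => /andP[? ?]; apply: floor_def; rewrite intrD; lra.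
Qed.

Lemma nearest_intD (x y : R) (m n : int) : `|x| < 2^-1 -> `|y| < 2^-1 ->
  nearest_int ((x + m%:~R) +i* (y + n%:~R))%C = (m%:~R +i* n%:~R)%C.
Proof. by move=> hx hy; rewrite /nearest_int /= !floor_half. Qed.

Lemma fundamental_setE : fundamental_set (hurwitz R) = unit_square R.
Proof.
apply/seteqP; split.
  have sq : [set z - hurwitz R z | z in setT] `<=` unit_square R.
    have aux (t : R) : `|t - (Num.floor (t + 2^-1))%:~R| <= 2^-1.
      have := floor_le (t + 2^-1); have := floorD1_gt (t + 2^-1).
      rewrite intrD ler_norml; move: (_%:~R) => n; lra.
    by move=> _ [[x y] _ <-] /=; split; exact: aux.
  rewrite unit_squareE in sq *.
  rewrite ((@closure_id R[i]^o _).1 (@region_closed R square_forms)).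
  exact: (@closureS R[i]^o).
move=> [x y] [/= hx hy] B /nbhs_complex[e e0 /= eB].
(* A point of the closed square is approached by its multiple by [1 - t], which is interior and
   rounds to 0. As [t <= e] and the modulus is below 1, the displacement is less than [e]. *)
pose t := e / (1 + e).
have t0 : 0 < t by rewrite divr_gt0//; lra.
have te : t <= e by rewrite ler_pdivrMr; nra.
have t1 : t < 1 by rewrite ltr_pdivrMr; lra.
clearbody t; have small s : `|s| <= 2^-1 -> `|s + - (t * s)| < 2^-1.
  by rewrite ler_norml ltr_norml => /andP[? ?]; apply/andP; split; nra.
exists ((x - t * x) +i* (y - t * y))%C; split; last first.
  apply: eB; rewrite !sqrrN !exprMn -mulrDr.
  move: hx hy; rewrite !ler_norml => /andP[? ?] /andP[? ?].
  have xy1 : x ^+ 2 + y ^+ 2 < 1 by nra.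
  apply: (@lt_le_trans _ _ (t ^+ 2)); last by rewrite ler_pXn2r ?nnegrE// ltW.
  by rewrite gtr_pMr// exprn_gt0.
exists ((x - t * x) +i* (y - t * y))%C => //=.
have := @nearest_intD (x - t * x) (y - t * y) 0 0 (small _ hx) (small _ hy).
by rewrite !addr0 => ->; rewrite subr0.
Qed.

(** A unit disc about [c] enters through [|z - c|^2 - 1], up to sign: [(1, 0, -2, 0)] for [c = 'i],
    [(1, 2, 0, 0)] for [c = -1], [(1, 2, -2, 1)] for [c = -1 + 'i]. *)
Fixpoint piece_forms (j : nat) : seq (R * R * R * R) :=
  match j with
  | 0 => [:: (0, -1, 0, 0), (1, 0, -2, 0), (1, 0, 2, 0) & square_forms]
  | 1 => [:: (-1, 0, 2, 0), (-1, -2, 0, 0), (1, 2, -2, 1) & square_forms]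
  | 2 => [:: (-1, -2, 2, -1) & square_forms]
  | j'.+3 => map rot_form (piece_forms j')
  end.

Lemma nat_ind3 (P : nat -> Prop) : P 0 -> P 1 -> P 2 ->
  (forall j, P j -> P j.+3) -> forall j, P j.
Proof.
move=> P0 P1 P2 P3 j; suff [] : [/\ P j, P j.+1 & P j.+2] by [].
by elim: j => [//|j [? ? ?]]; split => //; exact: P3.
Qed.

Lemma smooth_piece_forms j : all smooth_form (piece_forms j).
Proof.
elim/nat_ind3: j => [| | |j IH] /=; [by do !(apply/andP; split) => //; lra..|].
by rewrite all_map (eq_all (a2 := smooth_form))// => k; exact: smooth_rot_form.
Qed.

Lemma open_region_rot (L : seq (R * R * R * R)) (x y : R) :
  open_region (map rot_form L) (x +i* y)%C <-> open_region L (- y +i* x)%C.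
Proof.
rewrite /open_region/= all_map (eq_all (a2 := fun k => 0 < conic k (- y) x))//.
by move=> k /=; rewrite conic_rot_form.
Qed.

Lemma region_rot (L : seq (R * R * R * R)) (x y : R) :
  region (map rot_form L) (x +i* y)%C <-> region L (- y +i* x)%C.
Proof.
rewrite /region/= all_map (eq_all (a2 := fun k => 0 <= conic k (- y) x))//.
by move=> k /=; rewrite conic_rot_form.
Qed.

Lemma hurwitz_pieceE j : hurwitz_piece R j = region (piece_forms j).
Proof.
elim/nat_ind3: j => [| | |j IH] /=.
- rewrite fundamental_setE unit_squareE /region.
  apply/seteqP; split => -[x y] /=.
    rewrite !normcr_ge1/= => -[/and5P[/= ? ? ? ? _] ? ? ?].
    by do !(apply/andP; split) => //; lra.
  move=> /and4P[? ? ? sq]; split => //; first lra.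
    by rewrite normcr_ge1/=; lra.
  by rewrite normcr_ge1/=; lra.
- rewrite fundamental_setE unit_squareE /region.
  apply/seteqP; split => -[x y] /=.
    rewrite normcr_ge1 !normcr_le1/= => -[/and5P[/= ? ? ? ? _] ? ? ?].
    by do !(apply/andP; split) => //; lra.
  move=> /and4P[? ? ? sq].
  by split; rewrite // ?normcr_ge1 ?normcr_le1/=; lra.
- rewrite fundamental_setE unit_squareE /region.
  apply/seteqP; split => -[x y] /=.
    rewrite normcr_le1/= => -[/and5P[/= ? ? ? ? _] ?].
    by do !(apply/andP; split) => //; lra.
  by move=> /andP[? sq]; split; rewrite // normcr_le1/=; lra.
- rewrite IH; apply/seteqP; split => [_ [[x y] xy <-]|[x y] /region_rot h].
    rewrite (_ : _ * _ = (y +i* - x)%C) ?region_rot ?opprK//.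
    by apply/eqP; rewrite eq_complex/=; apply/andP; split; apply/eqP; ring.
  exists (- y +i* x)%C => //.
  by apply/eqP; rewrite eq_complex/=; apply/andP; split; apply/eqP; ring.
Qed.

(** * The pieces have disjoint interiors and cover the square *)

Lemma open_piece_neq0 j : open_region (piece_forms j) !=set0.
Proof.
elim/nat_ind3: j => [| | |j [[x y] h]].
- exists (- 4^-1 +i* 0)%C; do !(apply/andP; split) => //=; lra.
- exists (- 8^-1 +i* 8^-1)%C; do !(apply/andP; split) => //=; lra.
- exists (- (3 / 8) +i* (3 / 8))%C; do !(apply/andP; split) => //=; lra.
- by exists (y +i* - x)%C; rewrite /= open_region_rot opprK.
Qed.

(* Up to rotation the open pieces lie either in the sector |y| < - x outside
   the discs about 'i and - 'i, or in the discs about 'i and - 1. *)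
Fixpoint envelope_forms (j : nat) : seq (R * R * R * R) :=
  match j with
  | 0 => [:: (1, 0, -2, 0); (1, 0, 2, 0); (0, -1, -1, 0); (0, -1, 1, 0)]
  | 1 | 2 => [:: (-1, 0, 2, 0); (-1, -2, 0, 0)]
  | j'.+3 => map rot_form (envelope_forms j')
  end.

(** For the sector: [|x| <= |y| <= 2^-1] would give [x ^+ 2 + y ^+ 2 <= 2 * y ^+ 2 <= |y|], whereas
    outside both discs [x ^+ 2 + y ^+ 2 > 2 * |y|]. *)
Lemma open_piece_envelope j :
  open_region (piece_forms j) `<=` open_region (envelope_forms j).
Proof.
elim/nat_ind3: j => [| | |j IH] [x y].
- move=> /and5P[/= ? ? ? ? /and4P[/= ? ? ? _]].
  by do !(apply/andP; split) => //=; nra.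
- by move=> /and4P[/= ? ? ? _]; do !(apply/andP; split) => //=; lra.
- move=> /and5P[/= ? ? ? ? /andP[/= ? _]].
  by do !(apply/andP; split) => //=; lra.
- by rewrite /= !open_region_rot; exact: IH.
Qed.

Lemma open_piece_disjoint i j : (i < j < 12)%N ->
  open_region (piece_forms i) `&` open_region (piece_forms j) = set0.
Proof.
move=> ij; apply/seteqP; split => // z [zi zj]; move: ij z zi zj => /=.
elim/nat_ind3: i j => [| | |i IH] j; last first.
  (* Both indices are at least 3, so a quarter turn lowers them together. *)
  case: j => [|[|[|j]]] // /andP[]; rewrite !ltnS => ij j9 [x y].
  rewrite !open_region_rot; apply: IH; rewrite ij.
  exact: leq_trans j9 _.
(* Pieces 1 and 2 share an envelope; the circle about [-1 + 'i] separates them. For all other pairs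
   the envelopes are disjoint, by inequalities linear in [x], [y] and the squares. *)
2: case: (eqVneq j 2%N) => [-> _ [x y] /and4P[/= ? ? ? _] /andP[/= ? _]|j2];
  first lra.
all: move=> ij [x y] /open_piece_envelope + /open_piece_envelope.
all: have s0 : 0 <= x ^+ 2 + y ^+ 2 by rewrite addr_ge0 ?sqr_ge0.
2: move: j2.
all: case: j ij => [|[|[|[|[|[|[|[|[|[|[|[|j]]]]]]]]]]]] // _.
all: rewrite /open_region/=; do ?(case/andP => ?); move=> // _.
all: do !(case/andP => ?); move=> _; lra.
Qed.

(** The circles about ['i], [-1] and [-1 + 'i] decide in turn: outside the first disc is piece 0,
    outside the second is piece 3, and the third separates piece 1 from piece 2. *)
Lemma quadrant_cover (x y : R) : x <= 0 -> 0 <= y ->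
  region square_forms (x +i* y)%C ->
  exists2 j, (j <= 3)%N & region (piece_forms j) (x +i* y)%C.
Proof.
move=> x0 y0 /and5P[/= ? ? ? ? _].
have [?|?] := lerP (2 * y) (x ^+ 2 + y ^+ 2).
  by exists 0 => //; do !(apply/andP; split) => //=; lra.
have [?|?] := lerP (- 2 * x) (x ^+ 2 + y ^+ 2).
  by exists 3 => //; do !(apply/andP; split) => //=; lra.
have [?|?] := lerP 0 (x ^+ 2 + y ^+ 2 + 2 * x - 2 * y + 1).
  by exists 1 => //; do !(apply/andP; split) => //=; lra.
by exists 2 => //; do !(apply/andP; split) => //=; lra.
Qed.

Lemma piece_sub_square j : region (piece_forms j) `<=` region square_forms.
Proof.
elim/nat_ind3: j => [| | |j IH] [x y].
- by move=> /and4P[_ _ _].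
- by move=> /and4P[_ _ _].
- by move=> /andP[_].
- rewrite region_rot => /IH /and5P[/= ? ? ? ? _].
  by do !(apply/andP; split) => //=; lra.
Qed.

Lemma square_cover (z : R[i]) : region square_forms z ->
  exists j : 'I_12, region (piece_forms j) z.
Proof.
case: z => x y sq.
have sq1 : region square_forms (- y +i* x)%C.
  by move: sq => /and5P[/= ? ? ? ? _]; do !(apply/andP; split) => //=; lra.
have sq2 : region square_forms (- x +i* - y)%C.
  by move: sq => /and5P[/= ? ? ? ? _]; do !(apply/andP; split) => //=; lra.
have sq3 : region square_forms (y +i* - x)%C.
  by move: sq => /and5P[/= ? ? ? ? _]; do !(apply/andP; split) => //=; lra.
have [x0|x0] := lerP x 0; have [y0|y0] := lerP y 0.
- have [||j j3 h] := quadrant_cover _ _ sq3; [lra..|].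
  (* Here [j + 9] would be 12, out of range; four quarter turns are the identity, so the piece is
     number 0. *)
  have [j_3|j_3] := eqVneq j 3%N.
    by exists ord0; move: h; rewrite j_3 region_rot opprK.
  have j12 : (j.+3.+3.+3 < 12)%N by rewrite !ltnS -ltnS ltn_neqAle j_3.
  by exists (Ordinal j12); rewrite /= !region_rot opprK.
- have [||j j3 h] := quadrant_cover _ _ sq; [lra..|].
  have j12 : (j < 12)%N by rewrite ltnS (leq_trans j3).
  by exists (Ordinal j12).
- have [||j j3 h] := quadrant_cover _ _ sq2; [lra..|].
  have j12 : (j.+3.+3 < 12)%N by rewrite !ltnS (leq_trans j3).
  by exists (Ordinal j12); rewrite /= !region_rot.
- have [||j j3 h] := quadrant_cover _ _ sq1; [lra..|].
  have j12 : (j.+3 < 12)%N by rewrite !ltnS (leq_trans j3).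
  by exists (Ordinal j12); rewrite /= region_rot.
Qed.

Lemma hurwitz_partition :
  finite_partition (fundamental_set (hurwitz R))
    (fun j : 'I_12 => hurwitz_piece R j).
Proof.
split.
- by move=> j; rewrite hurwitz_pieceE; exact: region_closed.
- move=> j; rewrite hurwitz_pieceE.
  exact: region_boundary_null (smooth_piece_forms j).
- move=> i j ij; rewrite !hurwitz_pieceE.
  apply/seteqP; split => // z [].
  move=> /(interior_region (smooth_piece_forms i)) zi.
  move=> /(interior_region (smooth_piece_forms j)) zj.
  wlog lt_ij : i j ij zi zj / (i < j)%N.
    move: (ij); rewrite -val_eqE neq_ltn => /orP[] lt_ij h.
      exact: (h i j).
    by apply: (h j i) => //; rewrite eq_sym.
  have /seteqP[+ _] : open_region (piece_forms i) `&`
      open_region (piece_forms j) = set0 :> set R[i].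
    by apply: open_piece_disjoint; rewrite lt_ij ltn_ord.
  exact.
- rewrite fundamental_setE unit_squareE; apply/seteqP; split => z.
    by move=> [j _]; rewrite hurwitz_pieceE; exact: piece_sub_square.
  by move=> /square_cover[j zj]; exists j; rewrite //= hurwitz_pieceE.
Qed.

(** Equal pieces with distinct indices would have an interior disjoint from itself, yet it is
    nonempty. *)
Lemma hurwitz_piece_inj : injective (fun j : 'I_12 => hurwitz_piece R j).
Proof.
move=> i j ij; apply/eqP/negPn/negP => nij.
have [_ _ /(_ _ _ nij) + _] := hurwitz_partition.
rewrite -ij setIid hurwitz_pieceE => i0.
have [z zi] := open_piece_neq0 i.
by have := open_region_interior zi; rewrite i0.
Qed.

(** * Inversion and the images of the pieces under the Gauss map *)

Definition inv_form (k : R * R * R * R) : R * R * R * R :=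
  let: (a, b, c, d) := k in (d, - b, c, a).

(** The point is [-1 / u] for [u = p + q 'i]; multiplying the form there by [|u|^2] exchanges [a]
    with [d] and negates [b]. *)
Lemma conic_inv_form k (p q : R) : 0 < p ^+ 2 + q ^+ 2 ->
  0 <= conic (inv_form k) p q ->
  0 <= conic k (- (p / (p ^+ 2 + q ^+ 2))) (q / (p ^+ 2 + q ^+ 2)).
Proof.
case: k => [[[a b] c] d] /= s0 h.
rewrite -(pmulr_lge0 _ s0).
set s := p ^+ 2 + q ^+ 2 in s0 h *.
have sE : p ^+ 2 + q ^+ 2 = s by [].
rewrite sqrrN !expr_div_n -mulrDl sE.
rewrite (_ : _ * s = d * s - b * p + c * q + a) //; first lra.
by field; rewrite gt_eqF.
Qed.

Lemma gauss_preimage (j : nat) (x y : R) : `|x| < 2^-1 -> `|y| < 2^-1 ->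
  exists m n : int,
    0 < (x + m%:~R) ^+ 2 + (y + n%:~R) ^+ 2 /\
    all (fun k => 0 <= conic (inv_form k) (x + m%:~R) (y + n%:~R))
      (piece_forms j).
Proof.
elim/nat_ind3: j x y => [| | |j IH] x y hx hy.
all: move: (hx) (hy); rewrite !ltr_norml => /andP[? ?] /andP[? ?].
(* The sides of the square invert to unit circles about [1], [-1], ['i], [- 'i], whose open discs
   are excluded. The other forms leave the half-strip [0 <= p], [|q| <= 2^-1], and the square about
   3 is the first to clear the disc about 1. *)
- exists 3, 0; rewrite addr0 (_ : 3%:~R = 3)//; split; first by nra.
  by do !(apply/andP; split) => //=; nra.
(* The other forms now leave the quarter plane [p, q >= 2^-1] outside the disc about [1 + 'i]. *)
- exists 3, 3; rewrite (_ : 3%:~R = 3)//; split; first by nra.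
  by do !(apply/andP; split) => //=; nra.
(* The image is the disc about [1 + 'i] minus those about [1] and ['i]. Translated back to the unit
   square, the arcs bounding its four parts are centred at [-1 - 'i], [- 'i] and [-1], whence the
   three tests. *)
- have [?|?] := lerP 1 ((x + 1) ^+ 2 + (y + 1) ^+ 2); last first.
    exists 2, 2; rewrite (_ : 2%:~R = 2)//; split; first by nra.
    by do !(apply/andP; split) => //=; nra.
  have [?|?] := lerP (x ^+ 2 + (y + 1) ^+ 2) 1.
    exists 1, 2; rewrite (_ : 2%:~R = 2)// (_ : 1%:~R = 1)//; split.
      by nra.
    by do !(apply/andP; split) => //=; nra.
  have [?|?] := lerP ((x + 1) ^+ 2 + y ^+ 2) 1.
    exists 2, 1; rewrite (_ : 2%:~R = 2)// (_ : 1%:~R = 1)//; split.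
      by nra.
    by do !(apply/andP; split) => //=; nra.
  exists 1, 1; rewrite (_ : 1%:~R = 1)//; split; first by nra.
  by do !(apply/andP; split) => //=; nra.
(* Since [-1 / (- 'i * w) = 'i * (-1 / w)], the target is turned back by [- 'i]. *)
- have [|m [n [u0 h]]] := IH y (- x) hy; first by rewrite normrN.
  exists (- n), m; rewrite intrN.
  rewrite (_ : x - n%:~R = - (- x + n%:~R)); last by rewrite opprD opprK.
  rewrite sqrrN addrC; split=> //.
  rewrite all_map; apply: sub_all h => -[[[a b] c] d] /=; lra.
Qed.

Lemma gauss_map_inv (p q x y : R) (m n : int) :
  `|x| < 2^-1 -> `|y| < 2^-1 -> p = x + m%:~R -> q = y + n%:~R ->
  0 < p ^+ 2 + q ^+ 2 ->
  gauss_map (hurwitz R)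
    (- (p / (p ^+ 2 + q ^+ 2)) +i* (q / (p ^+ 2 + q ^+ 2)))%C
  = (x +i* y)%C.
Proof.
move=> hx hy pE qE s0; set z := (_ +i* _)%C.
have zu : z * (p +i* q)%C = -1.
  apply/eqP; rewrite /z eq_complex/=; apply/andP; split; apply/eqP.
    by field; rewrite gt_eqF.
  by field; rewrite gt_eqF.
have z0 : z != 0.
  by apply/eqP => z0; move: zu; rewrite z0 mul0r => /esym/eqP;
    rewrite oppr_eq0 oner_eq0.
rewrite /gauss_map (negPf z0) (_ : -1 / z = (p +i* q)%C); last first.
  by rewrite -zu mulrC mulKf.
rewrite /= pE qE nearest_intD//.
by apply/eqP; rewrite eq_complex/= !addrK !eqxx.
Qed.

Lemma hurwitz_buildable (j : nat) :
  buildable (fun i : 'I_12 => hurwitz_piece R i)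
    (gauss_map (hurwitz R) @` hurwitz_piece R j).
Proof.
have [_ _ _ cover] := hurwitz_partition.
(* All pieces are taken. The image lies in the square, and what it misses lies on the four sides,
   which are null. *)
exists setT; rewrite cover.
apply: (@C_null_subset R _ _ _ (conics_null (L := square_forms) _)); last first.
  by do !(apply/andP; split) => //=; lra.
move=> z [[[w _ <-] []]|].
  rewrite /gauss_map; case: ifPn => _; last first.
    by apply: (@subset_closure R[i]^o); exists (- 1 / w).
  by rewrite fundamental_setE /unit_square /= normr0; split; rewrite invr_ge0.
rewrite fundamental_setE unit_squareE => -[/allP zsq zim].
apply/negPn/negP => /hasPn h; apply: zim.
have : open_region square_forms z.
  by apply/allP => k kS; rewrite lt_neqAle eq_sym h// zsq.
case: z {h zsq} => x y /and5P[/= ? ? ? ? _].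
have hx : `|x| < 2^-1 by rewrite ltr_norml; apply/andP; split; lra.
have hy : `|y| < 2^-1 by rewrite ltr_norml; apply/andP; split; lra.
have [m [n [s0 /allP hj]]] := gauss_preimage j hx hy.
eexists; last exact: (gauss_map_inv hx hy erefl erefl s0).
rewrite hurwitz_pieceE; apply/allP => k kj /=.
exact: conic_inv_form (hj _ kj).
Qed.

End hurwitz.

Theorem proposition4p1 (R : realType) :
  fundamental_set (hurwitz R) = unit_square R /\
  finite_building_property (hurwitz R)
    (fun j : 'I_12 => hurwitz_piece R j).
Proof.
split; first exact: fundamental_setE.
split=> //; first exact: hurwitz_piece_inj.
- exact: hurwitz_partition.
- by move=> j; exact: hurwitz_buildable.
Qed.
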